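(* Let $\rho>1/2$ be real, let $\mu=\mu_R+i\mu_I$ be any complex number ($\mu_R,\mu_I\in\mathbb{R}$), and let $z\in\mathbb{C}$, $z\neq 0$, with a fixed choice of $\arg z$. Consider $$\Phi_{\rho,\mu}(\zeta,z)=\frac{\rho}{2\pi i}\,\frac{\exp\{(\zeta z)^{\rho}\}\,(\zeta z)^{\rho(1-\mu)}}{\zeta-1}$$ as a (possibly multivalued) analytic function of $\zeta$. In the finite $\zeta$-plane its only possible singular points are $\zeta=1$ and $\zeta=0$. The point $\zeta=1$ is a pole of the first order. The point $\zeta=0$ is: 1. a regular point of $\Phi_{\rho,\mu}(\cdot,z)$, if $\rho=n$ for some $n\in\{1,2,3,\dots\}$, $\mu_I=0$ and $\mu_R=1-m_1/\rho$ for some $m_1\in\{0,1,2,3,\dots\}$; 2. a pole of order $m_2$, if $\rho=n$ for some $n\in\{1,2,3,\dots\}$, $\mu_I=0$ and $\mu_R=1+m_2/\rho$ with $m_2\in\{1,2,3,\dots\}$; 3. a branch point, for all other values of the parameters $\rho,\mu_I,\mu_R$ (with $\rho>1/2$).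
   Context: The function $\Phi_{\rho,\mu}$ is the integrand of a contour-integral representation of the two-parameter Mittag-Leffler function. Powers are understood through polar form: for $\zeta=re^{i\varphi}$ and $z=te^{i\psi}$ with $r,t>0$ and $\varphi,\psi\in\mathbb{R}$, and for $a\in\mathbb{C}$, $(\zeta z)^{a}=\exp\{a(\ln(rt)+i(\varphi+\psi))\}$. Thus $\Phi_{\rho,\mu}(\zeta,z)$ is a function of $(r,\varphi)$, i.e. analytic in $\zeta$ on the Riemann surface of the logarithm (away from the points lying over $\zeta=1$). The point $\zeta=1$ being a pole of the first order means that every branch of the function has a simple pole there. The point $\zeta=0$ is a branch point if replacing $\varphi$ by $\varphi+2\pi$ (with $r,t,\psi$ fixed) does not leave the function unchanged, i.e. going once around $\zeta=0$ leads to a different element of the function. When the function is unchanged under $\varphi\mapsto\varphi+2\pi$, it is single-valued near $\zeta=0$; then ''regular point'' means that it is (or extends to be) holomorphic at $\zeta=0$, and ''pole of order $m_2$'' has its usual meaning. *)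

(* Defs.v *)
From Stdlib Require Export Reals.
From Coquelicot Require Export Coquelicot.
Open Scope C_scope.

Definition Cexp (w : C) : C :=
  ((exp (Re w) * cos (Im w))%R, (exp (Re w) * sin (Im w))%R).

Definition polar (r phi : R) : C := ((r * cos phi)%R, (r * sin phi)%R).

(* (r e^{i phi})^a, a function of the polar coordinates (r, phi), r > 0, and
   not of the complex number r e^{i phi} alone. *)
Definition polar_pow (r phi : R) (a : C) : C :=
  Cexp (a * (RtoC (ln r) + Ci * RtoC phi)).

(* A function on the Riemann surface of the logarithm is given by its values
   F r phi at the points (r, phi), r > 0; its values for r <= 0 are junk.
   Here zeta = r e^{i phi} and z = t e^{i psi}. *)
Definition Phi (rho : R) (mu : C) (t psi r phi : R) : C :=
  RtoC rho / (RtoC 2 * RtoC PI * Ci)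
  * (Cexp (polar_pow (r * t) (phi + psi) (RtoC rho))
     * polar_pow (r * t) (phi + psi) (RtoC rho * (1 - mu)))
  / (polar r phi - 1).

Definition holomorphic_at (f : C -> C) (c : C) : Prop :=
  locally c (fun w : C => @ex_derive C_AbsRing C_NormedModule f w).

Definition has_pole (f : C -> C) (m : nat) (c : C) : Prop :=
  (1 <= m)%nat /\
  exists h : C -> C, holomorphic_at h c /\ h c <> 0 /\
    locally' c (fun w : C => f w = h w / (w - c) ^ m).

(* In the next two definitions f, read near r0 e^{i phi0}, is the branch of F
   determined by the point (r0, phi0) of the surface. *)
Definition analytic_at (F : R -> R -> C) (r0 phi0 : R) : Prop :=
  exists f : C -> C, holomorphic_at f (polar r0 phi0) /\
    locally ((r0, phi0) : R * R)
      (fun p : R * R => F (fst p) (snd p) = f (polar (fst p) (snd p))).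

Definition pole_at (F : R -> R -> C) (m : nat) (r0 phi0 : R) : Prop :=
  exists f : C -> C, has_pole f m (polar r0 phi0) /\
    locally' ((r0, phi0) : R * R)
      (fun p : R * R => F (fst p) (snd p) = f (polar (fst p) (snd p))).

(* Going once around zeta = 0 does not change F over D. *)
Definition single_valued_on (D : C -> Prop) (F : R -> R -> C) : Prop :=
  forall r phi : R, (0 < r)%R -> D (polar r phi) ->
    F r (phi + 2 * PI)%R = F r phi.

(* F descends to the function f on a punctured neighbourhood of 0. *)
Definition induces_near_0 (F : R -> R -> C) (f : C -> C) : Prop :=
  exists eps : R, (0 < eps)%R /\
    forall r phi : R, (0 < r < eps)%R -> F r phi = f (polar r phi).

(* Below, the points over zeta = 1 are left out because the functions
   considered need not be defined there. *)
Definition regular_at_0 (F : R -> R -> C) : Prop :=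
  single_valued_on (fun w => w <> 1) F /\
  exists f : C -> C, holomorphic_at f 0 /\ induces_near_0 F f.

Definition pole_at_0 (F : R -> R -> C) (m : nat) : Prop :=
  single_valued_on (fun w => w <> 1) F /\
  exists f : C -> C, has_pole f m 0 /\ induces_near_0 F f.

(* Stated for arbitrarily small eps, so that the monodromy is that of the point
   zeta = 0; in particular F is not single-valued on the whole surface. *)
Definition branch_point_at_0 (F : R -> R -> C) : Prop :=
  forall eps : R, (0 < eps)%R ->
    ~ single_valued_on (fun w => (Cmod w < eps)%R /\ w <> 1) F.

Definition regular_params (rho : R) (mu : C) : Prop :=
  (exists n : nat, (1 <= n)%nat /\ rho = INR n) /\ Im mu = 0%R /\
  exists m1 : nat, Re mu = (1 - INR m1 / rho)%R.

Definition pole_params (rho : R) (mu : C) (m2 : nat) : Prop :=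
  (exists n : nat, (1 <= n)%nat /\ rho = INR n) /\ Im mu = 0%R /\
  (1 <= m2)%nat /\ Re mu = (1 + INR m2 / rho)%R.

(* Main.v *)
Require Import Defs.
From Stdlib Require Import ZArith Lra Lia.
Open Scope C_scope.

(** Write u = ln r + i phi + ln t + i psi for the logarithm of zeta z.  Then
    Phi = N(u) / (zeta - 1), where the entire function
      N(u) = rho / (2 pi i) exp(exp(rho u)) exp(rho (1 - mu) u)
    never vanishes ([Phi_numerator]).

    Near a point of the surface u is a holomorphic function of zeta
    ([local_logarithm]), so Phi is locally a nonvanishing holomorphic function
    divided by zeta - 1 ([Phi_local_form]).  This gives analyticity away from
    zeta = 1 and a simple pole over zeta = 1.

    If rho = n and rho (1 - mu) = k are integers, both powers are integral
    powers of zeta z, so that Phi = c exp((zeta z)^n) (zeta z)^k / (zeta - 1):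
    this is holomorphic at 0 for k >= 0 and has a pole of order -k for k < 0.

    Conversely, suppose that Phi is unchanged by a turn around zeta = 0 on some
    small circle.  A turn adds 2 pi i to u, so with q = exp(2 pi i rho) - 1 and
    m = exp(2 pi i rho (1 - mu)) the invariance reads
      exp(q exp(rho u)) m = 1
    for all u on a vertical line ([Phi_numerator_shift]).  Hence the real part
    of X = q exp(rho u) is constant on that line.  Moving u by i pi / rho
    changes X into -X, so Re X = 0; moving it by i pi / (2 rho) changes X into
    i X, so Im X = 0 as well.  Therefore q = 0 and m = 1
    ([Cexp_scal_eq_const]), which says that rho and rho (1 - mu) are integers
    ([exponents_integer]): these are the parameters of the first two cases. *)

(** * Complex differentiability *)

Notation C_derivable f w := (@ex_derive C_AbsRing C_NormedModule f w).

Lemma Cmod_le_Rabs_Re_Im (w : C) : (Cmod w <= Rabs (Re w) + Rabs (Im w))%R.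
Proof.
  replace w with (RtoC (Re w) + Ci * RtoC (Im w)) at 1
    by (apply injective_projections; simpl; unfold Re, Im; ring).
  eapply Rle_trans; [apply Cmod_triangle |].
  rewrite Cmod_mult, !Cmod_R.
  replace (Cmod Ci) with 1%R; [lra |].
  unfold Cmod; simpl.
  replace (0 * (0 * 1) + 1 * (1 * 1))%R with 1%R by ring. now rewrite sqrt_1.
Qed.

(** The functions [a] and [b] are the real and imaginary parts of f'.  Partial
    derivatives in x that exist near w and are continuous at w, together with
    partial derivatives in y at w, make the real and imaginary parts totally
    differentiable; the Cauchy-Riemann equations, built into the shape of the
    hypotheses, turn the real differential into multiplication by a + i b. *)
Lemma is_derive_of_cauchy_riemann (f : C -> C) (w : C) (a b : R -> R -> R) :
  locally w (fun p : C =>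
    is_derive (fun x : R => Re (f (x, Im p))) (Re p) (a (Re p) (Im p))) ->
  locally w (fun p : C =>
    is_derive (fun x : R => Im (f (x, Im p))) (Re p) (b (Re p) (Im p))) ->
  is_derive (fun y : R => Re (f (Re w, y))) (Im w) (- b (Re w) (Im w))%R ->
  is_derive (fun y : R => Im (f (Re w, y))) (Im w) (a (Re w) (Im w)) ->
  continuous (fun p : R * R => a (fst p) (snd p)) w ->
  continuous (fun p : R * R => b (fst p) (snd p)) w ->
  @is_derive C_AbsRing C_NormedModule f w (a (Re w) (Im w), b (Re w) (Im w)).
Proof.
  destruct w as [x0 y0]; simpl; intros Hux Hvx Huy Hvy Ca Cb.
  assert (Du := is_derive_filterdiff (fun x y => Re (f (x, y))) x0 y0 a _ Hux Huy Ca).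
  assert (Dv := is_derive_filterdiff (fun x y => Im (f (x, y))) x0 y0 b _ Hvx Hvy Cb).
  split; [apply is_linear_scal_l |].
  intros w Hw.
  apply (is_filter_lim_locally_unique (V := AbsRing_NormedModule C_AbsRing)) in Hw.
  change ((x0, y0) = w) in Hw; subst w; intros eps.
  destruct Du as [_ Du]; destruct Dv as [_ Dv].
  specialize (Du _ (fun P H => H) (pos_div_2 eps)).
  specialize (Dv _ (fun P H => H) (pos_div_2 eps)).
  apply (proj1 (locally_C (x0, y0) _)).
  generalize (filter_and _ _ Du Dv); apply filter_imp.
  intros [x y] [H1 H2].
  cbv beta in H1, H2.
  change (Rabs ((Re (f (x, y)) - Re (f (x0, y0)))
    - ((x - x0) * a x0 y0 + (y - y0) * - b x0 y0))
    <= eps / 2 * sqrt (Rabs (x - x0) ^ 2 + Rabs (y - y0) ^ 2))%R in H1.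
  change (Rabs ((Im (f (x, y)) - Im (f (x0, y0)))
    - ((x - x0) * b x0 y0 + (y - y0) * a x0 y0))
    <= eps / 2 * sqrt (Rabs (x - x0) ^ 2 + Rabs (y - y0) ^ 2))%R in H2.
  rewrite !pow2_abs in H1, H2.
  change (Cmod ((f (x, y) - f (x0, y0)) - ((x, y) - (x0, y0)) * (a x0 y0, b x0 y0))
    <= eps * sqrt ((x - x0) ^ 2 + (y - y0) ^ 2))%R.
  eapply Rle_trans; [apply Cmod_le_Rabs_Re_Im |].
  replace (Re (f (x, y) - f (x0, y0) - ((x, y) - (x0, y0)) * (a x0 y0, b x0 y0)))
    with ((Re (f (x, y)) - Re (f (x0, y0))) - ((x - x0) * a x0 y0 + (y - y0) * - b x0 y0))%R
    by (unfold Re; simpl; ring).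
  replace (Im (f (x, y) - f (x0, y0) - ((x, y) - (x0, y0)) * (a x0 y0, b x0 y0)))
    with ((Im (f (x, y)) - Im (f (x0, y0))) - ((x - x0) * b x0 y0 + (y - y0) * a x0 y0))%R
    by (unfold Im; simpl; ring).
  lra.
Qed.

(* The functions are passed explicitly: left to unification, the continuity
   rules would be tried on unfolded real operations, without end. *)
Ltac solve_continuous :=
  lazymatch goal with
  | |- continuous (fun p => (@?f p + @?g p)%R) _ =>
      apply (continuous_plus (V := R_NormedModule) f g); solve_continuous
  | |- continuous (fun p => (@?f p - @?g p)%R) _ =>
      apply (continuous_minus (V := R_NormedModule) f g); solve_continuous
  | |- continuous (fun p => (- @?f p)%R) _ =>
      apply (continuous_opp (V := R_NormedModule) f); solve_continuous
  | |- continuous (fun p => (@?f p * @?g p)%R) _ =>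
      apply (continuous_mult (K := R_AbsRing) f g); solve_continuous
  | |- continuous (fun p => exp (@?f p)) _ =>
      apply (continuous_comp f exp); [solve_continuous | apply continuous_exp]
  | |- continuous (fun p => cos (@?f p)) _ =>
      apply (continuous_comp f cos); [solve_continuous | apply continuous_cos]
  | |- continuous (fun p => sin (@?f p)) _ =>
      apply (continuous_comp f sin); [solve_continuous | apply continuous_sin]
  | |- continuous (fun p => (/ @?f p)%R) _ =>
      apply (continuous_comp f Rinv); [solve_continuous | apply continuous_Rinv]
  | |- continuous (fun p => fst p) _ =>
      apply (continuous_fst (U := R_UniformSpace) (V := R_UniformSpace))
  | |- continuous (fun p => snd p) _ =>
      apply (continuous_snd (U := R_UniformSpace) (V := R_UniformSpace))
  | |- continuous (fun p => ?c) _ => apply continuous_const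
  end.

Lemma C_derivable_Cexp w : C_derivable Cexp w.
Proof.
  eexists.
  apply (is_derive_of_cauchy_riemann Cexp w
    (fun x y => exp x * cos y)%R (fun x y => exp x * sin y)%R).
  - apply filter_forall; intros [x y]; simpl; auto_derive; auto; ring.
  - apply filter_forall; intros [x y]; simpl; auto_derive; auto; ring.
  - simpl; auto_derive; auto; ring.
  - simpl; auto_derive; auto; ring.
  - solve_continuous.
  - solve_continuous.
Qed.

Lemma locally_pos {U : UniformSpace} (g : U -> R) (x : U) :
  continuous g x -> (0 < g x)%R -> locally x (fun u => (0 < g u)%R).
Proof.
  intros Hg Hx.
  exact (Hg (fun y => 0 < y)%R (locally_open _ _ (open_gt 0) (fun y H => H) _ Hx)).
Qed.

Lemma sqr_norm_pos (x y : R) : (x, y) <> (0 : C) -> (0 < x * x + y * y)%R.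
Proof.
  intros H. destruct (Req_dec x 0) as [-> | Hx]; [| nra].
  destruct (Req_dec y 0) as [-> | Hy]; [| nra]. now elim H.
Qed.

Lemma C_derivable_Cinv (w : C) : w <> 0 -> C_derivable Cinv w.
Proof.
  intros Hw. destruct w as [x0 y0].
  assert (H0 := sqr_norm_pos _ _ Hw).
  assert (Hloc : locally ((x0, y0) : C)
    (fun p => 0 < fst p * fst p + snd p * snd p)%R)
    by (apply (locally_pos (U := C_UniformSpace)
          (fun p : R * R => fst p * fst p + snd p * snd p)%R); [solve_continuous | exact H0]).
  eexists.
  apply (is_derive_of_cauchy_riemann Cinv (x0, y0)
    (fun x y => (y * y - x * x) * / ((x * x + y * y) * (x * x + y * y)))%R
    (fun x y => 2 * x * y * / ((x * x + y * y) * (x * x + y * y)))%R).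
  - revert Hloc; apply filter_imp; intros [x y] Hxy; simpl in *.
    auto_derive; [nra | field; nra].
  - revert Hloc; apply filter_imp; intros [x y] Hxy; simpl in *.
    auto_derive; [nra | field; nra].
  - simpl; auto_derive; [nra | field; nra].
  - simpl; auto_derive; [nra | field; nra].
  - solve_continuous; simpl; nra.
  - solve_continuous; simpl; nra.
Qed.

(** This is a logarithm on the half-plane Re w > 0 only, where the argument is
    given by the arctangent. *)
Definition Clog (w : C) : C :=
  ((ln (Re w * Re w + Im w * Im w) / 2)%R, atan (Im w / Re w)).

Lemma C_derivable_Clog (w : C) : (0 < Re w)%R -> C_derivable Clog w.
Proof.
  intros Hw. destruct w as [x0 y0]. simpl in Hw.
  assert (Hloc : locally ((x0, y0) : C) (fun p => 0 < Re p)%R)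
    by (apply (locally_pos (U := C_UniformSpace) (fun p : R * R => fst p));
        [solve_continuous | exact Hw]).
  eexists.
  apply (is_derive_of_cauchy_riemann Clog (x0, y0)
    (fun x y => x * / (x * x + y * y))%R (fun x y => - y * / (x * x + y * y))%R).
  - revert Hloc; apply filter_imp; intros [x y] Hxy; simpl in *.
    auto_derive; [nra | field; nra].
  - revert Hloc; apply filter_imp; intros [x y] Hxy; simpl in *.
    auto_derive; [nra | field; nra].
  - simpl; auto_derive; [nra | field; nra].
  - simpl; auto_derive; [nra | field; nra].
  - solve_continuous; simpl; nra.
  - solve_continuous; simpl; nra.
Qed.

Lemma C_derivable_const (c w : C) : C_derivable (fun _ => c) w.
Proof. apply ex_derive_const. Qed.

(** The field C regarded as a normed module over itself and [C_NormedModule] are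
    two structures, not convertible, with the same operations and norm.  The
    product and chain rules speak of the first one. *)
Lemma is_derive_AbsRing_C (f : C -> C) (w l : C) :
  @is_derive C_AbsRing C_NormedModule f w l <->
  @is_derive C_AbsRing (AbsRing_NormedModule C_AbsRing) f w l.
Proof.
  split; intros [_ H]; (split; [apply is_linear_scal_l | exact H]).
Qed.

Lemma C_derivable_id (w : C) : C_derivable (fun u => u) w.
Proof.
  eexists. apply is_derive_AbsRing_C. exact (is_derive_id (K := C_AbsRing) w).
Qed.

Lemma C_derivable_plus (f g : C -> C) (w : C) :
  C_derivable f w -> C_derivable g w -> C_derivable (fun u => f u + g u) w.
Proof. apply (ex_derive_plus (V := C_NormedModule)). Qed.

Lemma C_derivable_mult (f g : C -> C) (w : C) :
  C_derivable f w -> C_derivable g w -> C_derivable (fun u => f u * g u) w.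
Proof.
  intros [df Hf] [dg Hg]. apply is_derive_AbsRing_C in Hf, Hg.
  eexists; apply is_derive_AbsRing_C.
  exact (is_derive_mult (K := C_AbsRing) f g w df dg Hf Hg Cmult_comm).
Qed.

Lemma C_derivable_comp (f g : C -> C) (w : C) :
  C_derivable f (g w) -> C_derivable g w -> C_derivable (fun u => f (g u)) w.
Proof.
  intros Hf [dg Hg]. apply is_derive_AbsRing_C in Hg.
  apply (ex_derive_comp (V := C_NormedModule) f g w Hf). now exists dg.
Qed.

Lemma C_derivable_pow (f : C -> C) (n : nat) (w : C) :
  C_derivable f w -> C_derivable (fun u => f u ^ n) w.
Proof.
  intros Hf. induction n as [| n IH].
  - exact (C_derivable_const 1 w).
  - exact (C_derivable_mult _ _ _ Hf IH).
Qed.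

Lemma C_derivable_div_sub_1 (f : C -> C) (w : C) :
  w <> 1 -> C_derivable f w -> C_derivable (fun u => f u / (u - 1)) w.
Proof.
  intros Hw Hf. apply C_derivable_mult; [exact Hf |].
  apply (C_derivable_comp Cinv (fun u => u - 1)).
  - apply C_derivable_Cinv. intros E. apply Hw.
    replace w with (w - 1 + 1) by ring. rewrite E. ring.
  - apply C_derivable_plus; [apply C_derivable_id | apply C_derivable_const].
Qed.

(** * Exponential, logarithm and polar coordinates *)

Lemma Cexp_plus (u v : C) : Cexp (u + v) = Cexp u * Cexp v.
Proof.
  destruct u as [x y], v as [x' y']; unfold Cexp; simpl. rewrite exp_plus, cos_plus, sin_plus.
  apply injective_projections; simpl; ring.
Qed.

Lemma Cmod_Cexp (u : C) : Cmod (Cexp u) = exp (Re u).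
Proof.
  unfold Cmod, Cexp; simpl.
  assert (H := sin2_cos2 (Im u)); unfold Rsqr in H.
  replace (_ + _)%R with (exp (Re u) * exp (Re u)
    * (sin (Im u) * sin (Im u) + cos (Im u) * cos (Im u)))%R by ring.
  rewrite H, Rmult_1_r. apply sqrt_square. left; apply exp_pos.
Qed.

Lemma Cexp_neq_0 (u : C) : Cexp u <> 0.
Proof.
  apply Cmod_gt_0. rewrite Cmod_Cexp. apply exp_pos.
Qed.

Lemma Cexp_0 : Cexp 0 = 1.
Proof.
  unfold Cexp; simpl. rewrite exp_0, cos_0, sin_0.
  apply injective_projections; simpl; ring.
Qed.

Lemma Cexp_opp (u : C) : Cexp (- u) = / Cexp u.
Proof.
  assert (H := Cexp_neq_0 u).
  replace (Cexp (- u)) with (Cexp (- u + u) * / Cexp u).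
  - rewrite Cplus_comm, Cplus_opp_r, Cexp_0. ring.
  - rewrite Cexp_plus. field. exact H.
Qed.

Lemma Cexp_mult_INR (n : nat) (u : C) : Cexp (RtoC (INR n) * u) = Cexp u ^ n.
Proof.
  induction n as [| n IH].
  - simpl. replace (0 * u) with (RtoC 0) by ring. apply Cexp_0.
  - rewrite S_INR, RtoC_plus, Cmult_plus_distr_r, Cexp_plus, IH, Cmult_1_l, Cpow_S.
    ring.
Qed.

(** The modulus gives Re v = 0; then cos (Im v) = 1 means sin (Im v / 2) = 0. *)
Lemma Cexp_eq_1 (v : C) : Cexp v = 1 -> exists k : Z, v = 2 * PI * Ci * IZR k.
Proof.
  intros H.
  assert (Hre : Re v = 0%R).
  { apply exp_inv. rewrite <- Cmod_Cexp, H, Cmod_1, exp_0. reflexivity. }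
  assert (Hc : cos (Im v) = 1%R).
  { apply (f_equal Re) in H. unfold Cexp in H; simpl in H.
    rewrite Hre, exp_0 in H. lra. }
  replace (Im v) with (2 * (Im v / 2))%R in Hc by field.
  rewrite cos_2a_sin in Hc.
  assert (Hs : sin (Im v / 2) = 0%R) by nra.
  destruct (sin_eq_0_0 _ Hs) as [k Hk]. exists k.
  unfold Re in Hre; unfold Im in Hk.
  apply injective_projections; simpl; [rewrite Hre; ring | lra].
Qed.

Lemma polar_eq_Cexp (r phi : R) :
  (0 < r)%R -> polar r phi = Cexp (RtoC (ln r) + Ci * RtoC phi).
Proof.
  intros Hr. unfold polar, Cexp; simpl.
  replace (ln r + (0 * phi - 1 * 0))%R with (ln r) by ring.
  replace (0 + (0 * 0 + 1 * phi))%R with phi by ring.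
  now rewrite exp_ln.
Qed.

Lemma polar_mult (r s a b : R) : polar r a * polar s b = polar (r * s) (a + b).
Proof.
  unfold polar. rewrite cos_plus, sin_plus.
  apply injective_projections; simpl; ring.
Qed.

Lemma polar_period (r phi : R) : polar r (phi + 2 * PI) = polar r phi.
Proof.
  unfold polar. now rewrite cos_plus, sin_plus, cos_2PI, sin_2PI,
    !Rmult_1_r, !Rmult_0_r, Rminus_0_r, Rplus_0_r.
Qed.

Lemma Cmod_polar (r phi : R) : (0 < r)%R -> Cmod (polar r phi) = r.
Proof.
  intros Hr. rewrite polar_eq_Cexp, Cmod_Cexp by assumption. simpl.
  replace (ln r + (0 * phi - 1 * 0))%R with (ln r) by ring. now apply exp_ln.
Qed.

Lemma Clog_polar (r phi : R) :
  (0 < r)%R -> (- PI / 2 < phi < PI / 2)%R ->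
  Clog (polar r phi) = RtoC (ln r) + Ci * RtoC phi.
Proof.
  intros Hr Hphi.
  assert (Hc : (0 < cos phi)%R) by (apply cos_gt_0; lra).
  unfold Clog, polar; simpl.
  replace (r * cos phi * (r * cos phi) + r * sin phi * (r * sin phi))%R with (r * r)%R.
  2:{ assert (H := sin2_cos2 phi); unfold Rsqr in H.
    transitivity (r * r * (sin phi * sin phi + cos phi * cos phi))%R; [rewrite H |]; ring. }
  replace (r * sin phi / (r * cos phi))%R with (tan phi) by (unfold tan; field; lra).
  rewrite ln_mult, atan_tan by lra.
  apply injective_projections; simpl; field.
Qed.

(** The branch of the logarithm through the point (r0, phi0) is obtained by
    rotating and scaling that point to 1, where the principal branch is
    available, and adding ln r0 + i phi0 back. *)
Lemma local_logarithm (r0 phi0 : R) :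
  (0 < r0)%R ->
  exists L : C -> C, holomorphic_at L (polar r0 phi0) /\
    locally ((r0, phi0) : R * R) (fun p : R * R => (0 < fst p)%R /\
      L (polar (fst p) (snd p)) = RtoC (ln (fst p)) + Ci * RtoC (snd p)).
Proof.
  intros Hr0.
  set (c := polar (/ r0) (- phi0)).
  assert (Hinv : (0 < / r0)%R) by now apply Rinv_0_lt_compat.
  exists (fun w => (RtoC (ln r0) + Ci * RtoC phi0) + Clog (w * c)). split.
  - assert (Hloc : locally (polar r0 phi0) (fun w : C => 0 < fst w * fst c - snd w * snd c)%R).
    { apply (locally_pos (U := C_UniformSpace)
        (fun w : R * R => fst w * fst c - snd w * snd c)%R); [solve_continuous |].
      assert (E : polar r0 phi0 * c = 1).
      { unfold c. rewrite polar_mult, Rinv_r, Rplus_opp_r by lra.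
        unfold polar. rewrite cos_0, sin_0. apply injective_projections; simpl; ring. }
      apply (f_equal Re) in E. simpl in E |- *. unfold c in *; simpl in *. lra. }
    revert Hloc; unfold holomorphic_at; apply filter_imp; intros w Hw.
    apply C_derivable_plus; [apply C_derivable_const |].
    apply (C_derivable_comp Clog (fun w => w * c)).
    + apply C_derivable_Clog. exact Hw.
    + apply C_derivable_mult; [apply C_derivable_id | apply C_derivable_const].
  - assert (H1 : locally ((r0, phi0) : R * R) (fun p => 0 < fst p)%R)
      by (apply (locally_pos (fun p : R * R => fst p)); [solve_continuous | exact Hr0]).
    assert (HPI := PI_RGT_0).
    assert (H2 : locally ((r0, phi0) : R * R) (fun p => 0 < snd p - phi0 + PI / 2)%R)
      by (apply (locally_pos (fun p : R * R => snd p - phi0 + PI / 2)%R);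
          [solve_continuous | simpl; lra]).
    assert (H3 : locally ((r0, phi0) : R * R) (fun p => 0 < phi0 - snd p + PI / 2)%R)
      by (apply (locally_pos (fun p : R * R => phi0 - snd p + PI / 2)%R);
          [solve_continuous | simpl; lra]).
    generalize (filter_and _ _ H1 (filter_and _ _ H2 H3)); apply filter_imp.
    intros [r phi] [Hr [Ha Hb]]; simpl in *. split; [exact Hr |].
    unfold c. rewrite polar_mult, Clog_polar.
    + rewrite ln_mult, ln_Rinv, RtoC_plus, !RtoC_plus, !RtoC_opp by assumption. ring.
    + now apply Rmult_lt_0_compat.
    + lra.
Qed.

Lemma polar_pow_mult (r t phi psi : R) (a : C) :
  (0 < r)%R -> (0 < t)%R ->
  polar_pow (r * t) (phi + psi) a =
  Cexp (a * ((RtoC (ln r) + Ci * RtoC phi) + (RtoC (ln t) + Ci * RtoC psi))).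
Proof.
  intros Hr Ht. unfold polar_pow. rewrite ln_mult, !RtoC_plus by assumption.
  f_equal. ring.
Qed.

Lemma polar_pow_INR (r phi : R) (n : nat) :
  (0 < r)%R -> polar_pow r phi (RtoC (INR n)) = polar r phi ^ n.
Proof.
  intros Hr. unfold polar_pow. now rewrite Cexp_mult_INR, polar_eq_Cexp.
Qed.

Lemma polar_pow_opp_INR (r phi : R) (n : nat) :
  (0 < r)%R -> polar_pow r phi (- RtoC (INR n)) = / polar r phi ^ n.
Proof.
  intros Hr. rewrite <- polar_pow_INR by assumption. unfold polar_pow.
  rewrite <- Cexp_opp. f_equal. ring.
Qed.

(** * Local form of the integrand *)

Definition Phi_numerator (rho : R) (mu u : C) : C :=
  RtoC rho / (RtoC 2 * RtoC PI * Ci)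
  * (Cexp (Cexp (RtoC rho * u)) * Cexp (RtoC rho * (1 - mu) * u)).

Lemma Phi_eq (rho : R) (mu : C) (t psi r phi : R) :
  (0 < r)%R -> (0 < t)%R ->
  Phi rho mu t psi r phi =
  Phi_numerator rho mu ((RtoC (ln r) + Ci * RtoC phi) + (RtoC (ln t) + Ci * RtoC psi))
  / (polar r phi - 1).
Proof.
  intros Hr Ht. unfold Phi, Phi_numerator. now rewrite !polar_pow_mult.
Qed.

Lemma prefactor_neq_0 (rho : R) :
  rho <> 0%R -> RtoC rho / (RtoC 2 * RtoC PI * Ci) <> 0.
Proof.
  intros Hrho.
  assert (HCi : Ci <> 0) by (intros E; injection E; lra).
  assert (HPI : RtoC PI <> 0) by (intros E; injection E; apply PI_neq0).
  assert (Hr : RtoC rho <> 0) by (intros E; injection E; exact Hrho).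
  assert (H2 : RtoC 2 <> 0) by (intros E; injection E; lra).
  intros E. apply Hr.
  replace (RtoC rho) with
    (RtoC rho / (RtoC 2 * RtoC PI * Ci) * (RtoC 2 * RtoC PI * Ci)) by (field; auto).
  rewrite E. ring.
Qed.

Lemma Cinv_neq_0 (w : C) : w <> 0 -> / w <> 0.
Proof.
  intros Hw E. assert (H := Cinv_r w Hw). rewrite E, Cmult_0_r in H.
  injection H; lra.
Qed.

Lemma Phi_numerator_neq_0 (rho : R) (mu u : C) :
  rho <> 0%R -> Phi_numerator rho mu u <> 0.
Proof.
  intros Hrho. unfold Phi_numerator.
  apply Cmult_neq_0; [now apply prefactor_neq_0 |].
  apply Cmult_neq_0; apply Cexp_neq_0.
Qed.

Lemma locally_neq_1 (w : C) : w <> 1 -> locally w (fun u : C => u <> 1).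
Proof.
  intros Hw.
  assert (H : locally w (fun u : C => 0 < (fst u - 1) * (fst u - 1) + snd u * snd u)%R).
  { apply (locally_pos (U := C_UniformSpace)
      (fun u : R * R => (fst u - 1) * (fst u - 1) + snd u * snd u)%R); [solve_continuous |].
    apply sqr_norm_pos. intros E. apply Hw.
    apply injective_projections; simpl; injection E; intros; lra. }
  revert H; apply filter_imp; intros u Hu ->. simpl in Hu. lra.
Qed.

Lemma Phi_local_form (rho : R) (mu : C) (t psi r0 phi0 : R) :
  rho <> 0%R -> (0 < t)%R -> (0 < r0)%R ->
  exists h : C -> C, holomorphic_at h (polar r0 phi0) /\ h (polar r0 phi0) <> 0 /\
    locally ((r0, phi0) : R * R) (fun p : R * R =>
      Phi rho mu t psi (fst p) (snd p)
      = h (polar (fst p) (snd p)) / (polar (fst p) (snd p) - 1)).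
Proof.
  intros Hrho Ht Hr0.
  destruct (local_logarithm r0 phi0 Hr0) as [L [HL Hloc]].
  exists (fun w => Phi_numerator rho mu (L w + (RtoC (ln t) + Ci * RtoC psi))).
  split; [| split].
  - revert HL; unfold holomorphic_at; apply filter_imp; intros w Hw.
    assert (Hu : C_derivable (fun w => L w + (RtoC (ln t) + Ci * RtoC psi)) w)
      by (apply C_derivable_plus; [exact Hw | apply C_derivable_const]).
    assert (Hexp : forall (a : C) (g : C -> C), C_derivable g w ->
      C_derivable (fun w => Cexp (a * g w)) w).
    { intros a g Hg. apply (C_derivable_comp Cexp); [apply C_derivable_Cexp |].
      apply C_derivable_mult; [apply C_derivable_const | exact Hg]. }
    unfold Phi_numerator.
    apply C_derivable_mult; [apply C_derivable_const |].
    apply C_derivable_mult; [| now apply Hexp].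
    apply (C_derivable_comp Cexp); [apply C_derivable_Cexp | now apply Hexp].
  - now apply Phi_numerator_neq_0.
  - revert Hloc; apply filter_imp; intros p [Hp E].
    rewrite Phi_eq, E by assumption. reflexivity.
Qed.

Lemma descends_at_0 (F : R -> R -> C) (f : C -> C) :
  (forall r phi : R, (0 < r)%R -> F r phi = f (polar r phi)) ->
  single_valued_on (fun w => w <> 1) F /\ induces_near_0 F f.
Proof.
  intros H. split.
  - intros r phi Hr _. now rewrite !H, polar_period.
  - exists 1%R. split; [lra |]. intros r phi Hr. apply H. lra.
Qed.

(** * Monodromy around zeta = 0 *)

Lemma Cexp_Ci (alpha : R) : Cexp (Ci * RtoC alpha) = (cos alpha, sin alpha).
Proof.
  unfold Cexp; simpl.
  replace (0 * 0 + 1 * alpha)%R with alpha by ring.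
  replace (0 * alpha - 1 * 0)%R with 0%R by ring.
  now rewrite exp_0, !Rmult_1_l.
Qed.

(** The exponent X = q exp(rho (s + i theta)) has constant real part, because
    exp(Re X) |m| = 1.  The rotations of X by pi and by pi / 2, which are
    translations of theta by pi / rho and pi / (2 rho), then force X = 0. *)
Lemma Cexp_scal_eq_const (q m : C) (rho s : R) :
  rho <> 0%R ->
  (forall theta : R,
    Cexp (q * Cexp (RtoC rho * (RtoC s + Ci * RtoC theta))) * m = 1) ->
  q = 0 /\ m = 1.
Proof.
  intros Hrho H.
  set (X := fun theta : R => q * Cexp (RtoC rho * (RtoC s + Ci * RtoC theta))).
  assert (Hrot : forall theta alpha : R,
    X (theta + alpha / rho)%R = X theta * Cexp (Ci * RtoC alpha)).
  { intros theta alpha. unfold X. rewrite <- Cmult_assoc, <- Cexp_plus. do 2 f_equal.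
    apply injective_projections; simpl; field; exact Hrho. }
  assert (Hmod : forall theta : R, (exp (Re (X theta)) * Cmod m = 1)%R).
  { intros theta. rewrite <- Cmod_Cexp, <- Cmod_mult. unfold X. rewrite H. apply Cmod_1. }
  assert (Hre : forall theta : R, Re (X theta) = 0%R).
  { intros theta. assert (H1 := Hmod theta). assert (H2 := Hmod (theta + PI / rho)%R).
    assert (E : Re (X (theta + PI / rho)%R) = (- Re (X theta))%R).
    { rewrite Hrot, Cexp_Ci, cos_PI, sin_PI. destruct (X theta); simpl; ring. }
    rewrite E in H2. rewrite <- H2 in H1.
    assert (Hm : Cmod m <> 0%R) by (intros Em; rewrite Em, Rmult_0_r in H2; lra).
    apply Rmult_eq_reg_r in H1; [| exact Hm]. apply exp_inv in H1. lra. }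
  assert (Him : Im (X 0%R) = 0%R).
  { assert (H1 := Hre (0 + (PI / 2) / rho)%R).
    rewrite Hrot, Cexp_Ci, cos_PI2, sin_PI2 in H1. destruct (X 0%R); simpl in *; lra. }
  assert (HX : X 0%R = 0) by (apply injective_projections; [apply Hre | exact Him]).
  split.
  - assert (Hn := Cexp_neq_0 (RtoC rho * (RtoC s + Ci * RtoC 0))).
    unfold X in HX.
    replace q with (q * Cexp (RtoC rho * (RtoC s + Ci * RtoC 0)) /
      Cexp (RtoC rho * (RtoC s + Ci * RtoC 0))) by (field; exact Hn).
    rewrite HX. unfold Cdiv. ring.
  - assert (H0 := H 0%R). fold (X 0%R) in H0. rewrite HX, Cexp_0 in H0.
    rewrite <- H0. ring.
Qed.

(** The quotient of the two values of the numerator, computed with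
    exp(rho (u + 2 pi i)) = exp(rho u) + q exp(rho u). *)
Lemma Phi_numerator_shift (rho : R) (mu u : C) :
  rho <> 0%R ->
  Phi_numerator rho mu (u + 2 * PI * Ci) = Phi_numerator rho mu u ->
  Cexp ((Cexp (2 * PI * Ci * RtoC rho) - 1) * Cexp (RtoC rho * u))
  * Cexp (2 * PI * Ci * (RtoC rho * (1 - mu))) = 1.
Proof.
  intros Hrho E.
  assert (Hn := Phi_numerator_neq_0 rho mu u Hrho).
  transitivity (Phi_numerator rho mu (u + 2 * PI * Ci) / Phi_numerator rho mu u);
    [| rewrite E; field; exact Hn].
  unfold Phi_numerator in *.
  set (e := Cexp (2 * PI * Ci * RtoC rho)).
  set (m := Cexp (2 * PI * Ci * (RtoC rho * (1 - mu)))).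
  replace (Cexp (RtoC rho * (u + 2 * PI * Ci)))
    with (Cexp (RtoC rho * u) + (e - 1) * Cexp (RtoC rho * u)).
  2:{ unfold e. transitivity (Cexp (2 * PI * Ci * RtoC rho) * Cexp (RtoC rho * u)); [ring |].
      rewrite <- Cexp_plus. f_equal. ring. }
  replace (RtoC rho * (1 - mu) * (u + 2 * PI * Ci)) with
    (RtoC rho * (1 - mu) * u + 2 * PI * Ci * (RtoC rho * (1 - mu))) by ring.
  rewrite (Cexp_plus (Cexp _)), (Cexp_plus (RtoC rho * (1 - mu) * u)). fold m.
  assert (Hc := prefactor_neq_0 rho Hrho).
  set (c := RtoC rho / _) in *.
  set (A := Cexp (Cexp (RtoC rho * u))) in *. set (B := Cexp (RtoC rho * (1 - mu) * u)) in *.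
  assert (HA : A <> 0) by apply Cexp_neq_0. assert (HB : B <> 0) by apply Cexp_neq_0.
  field. auto.
Qed.

(** The invariance is read off on one circle around zeta = 0 of radius less than
    both eps and 1, hence away from zeta = 1; as phi runs over R, the logarithm
    u runs over a whole vertical line. *)
Lemma exponents_integer (rho : R) (mu : C) (t psi : R) :
  rho <> 0%R -> (0 < t)%R -> ~ branch_point_at_0 (Phi rho mu t psi) ->
  (exists k : Z, rho = IZR k) /\ exists k : Z, RtoC rho * (1 - mu) = IZR k.
Proof.
  intros Hrho Ht Hbr.
  enough (H : Cexp (2 * PI * Ci * RtoC rho) - 1 = 0 /\
    Cexp (2 * PI * Ci * (RtoC rho * (1 - mu))) = 1).
  { assert (Hint : forall a : C, Cexp (2 * PI * Ci * a) = 1 -> exists k : Z, a = IZR k).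
    { intros a Ha. destruct (Cexp_eq_1 _ Ha) as [k Hk]. exists k.
      assert (HPI := PI_RGT_0). destruct a as [x y].
      injection Hk; simpl; intros. apply injective_projections; simpl; nra. }
    destruct H as [H1 H2]. split; [| now apply Hint].
    destruct (Hint (RtoC rho)) as [k Hk].
    - replace (Cexp (2 * PI * Ci * RtoC rho))
        with (Cexp (2 * PI * Ci * RtoC rho) - 1 + 1) by ring.
      rewrite H1. ring.
    - exists k. now injection Hk. }
  apply Classical_Prop.NNPP. intros Hno. apply Hbr. intros eps Heps Hsv. apply Hno.
  set (r := (Rmin eps 1 / 2)%R).
  assert (Hr : (0 < r < 1 /\ r < eps)%R).
  { unfold r. assert (H1 := Rmin_l eps 1). assert (H2 := Rmin_r eps 1).
    assert (H3 := Rmin_pos eps 1 Heps Rlt_0_1). lra. }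
  apply (Cexp_scal_eq_const _ _ rho (ln r + ln t) Hrho). intros theta.
  apply Phi_numerator_shift; [exact Hrho |].
  assert (Hcm := Cmod_polar r (theta - psi) ltac:(lra)).
  assert (Hne : polar r (theta - psi) <> 1).
  { intros E. rewrite E, Cmod_1 in Hcm. lra. }
  assert (E := Hsv r (theta - psi)%R ltac:(lra) ltac:(split; [lra | exact Hne])).
  rewrite !Phi_eq, polar_period in E by lra.
  assert (Hd : polar r (theta - psi) - 1 <> 0).
  { intros Ed. apply Hne.
    transitivity (polar r (theta - psi) - 1 + 1); [ring | rewrite Ed; ring]. }
  apply (f_equal (fun v => v * (polar r (theta - psi) - 1))) in E.
  unfold Cdiv in E. rewrite <- !Cmult_assoc, !Cinv_l, !Cmult_1_r in E by exact Hd.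
  replace (RtoC (ln r + ln t) + Ci * RtoC theta) with
    (RtoC (ln r) + Ci * RtoC (theta - psi) + (RtoC (ln t) + Ci * RtoC psi))
    by (rewrite RtoC_plus, RtoC_minus; ring).
  rewrite <- E. f_equal.
  rewrite RtoC_plus, RtoC_mult, RtoC_minus. ring.
Qed.

(** * Classification of the singular points *)

Theorem theorem1 (rho : R) (mu z : C) (psi : R)
    (hrho : (1 / 2 < rho)%R) (hz : z <> 0)
    (hpsi : z = polar (Cmod z) psi) :
  let F := Phi rho mu (Cmod z) psi in
  (forall r phi : R, (0 < r)%R -> polar r phi <> 1 -> analytic_at F r phi) /\
  (forall r phi : R, (0 < r)%R -> polar r phi = 1 -> pole_at F 1 r phi) /\
  (regular_params rho mu -> regular_at_0 F) /\
  (forall m2 : nat, pole_params rho mu m2 -> pole_at_0 F m2) /\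
  (~ regular_params rho mu -> (forall m2 : nat, ~ pole_params rho mu m2) ->
    branch_point_at_0 F).
Proof.
  intros F.
  assert (Hrho : rho <> 0%R) by lra.
  assert (Ht : (0 < Cmod z)%R) by now apply Cmod_gt_0.
  assert (Hz : forall r phi, polar (r * Cmod z) (phi + psi) = polar r phi * z).
  { intros r phi. rewrite hpsi at 2. now rewrite polar_mult. }
  assert (Hnear0 : locally (0 : C) (fun w : C => w <> 1)).
  { apply locally_neq_1. intros E. injection E. lra. }
  split; [| split; [| split; [| split]]].
  - intros r phi Hr Hne.
    destruct (Phi_local_form rho mu (Cmod z) psi r phi Hrho Ht Hr) as [h [Hh [_ Hloc]]].
    exists (fun w => h w / (w - 1)). split; [| exact Hloc].
    generalize (filter_and _ _ (locally_neq_1 _ Hne) Hh).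
    unfold holomorphic_at; apply filter_imp; intros w [Hw1 Hw2].
    now apply C_derivable_div_sub_1.
  - intros r phi Hr E1.
    destruct (Phi_local_form rho mu (Cmod z) psi r phi Hrho Ht Hr) as [h [Hh [Hne Hloc]]].
    exists (fun w => h w / (w - 1)). split.
    + split; [lia |]. exists h. split; [exact Hh | split; [exact Hne |]].
      rewrite E1. apply filter_forall. intros w. now rewrite Cpow_1_r.
    + revert Hloc; unfold locally', within; apply filter_imp; auto.
  - intros [[n [Hn En]] [Himu [m Em]]].
    assert (Ea : RtoC rho * (1 - mu) = RtoC (INR m)).
    { apply injective_projections; simpl; unfold Re, Im in *; rewrite ?Em, ?Himu; field; lra. }
    set (f := fun w => RtoC rho / (RtoC 2 * RtoC PI * Ci)
      * (Cexp ((w * z) ^ n) * (w * z) ^ m) / (w - 1)).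
    destruct (descends_at_0 F f) as [H1 H2].
    { intros r phi Hr. unfold F, Phi, f. rewrite Ea, En.
      rewrite !polar_pow_INR, !Hz by now apply Rmult_lt_0_compat. reflexivity. }
    split; [exact H1 |]. exists f. split; [| exact H2].
    revert Hnear0; unfold holomorphic_at; apply filter_imp; intros w Hw.
    apply C_derivable_div_sub_1; [exact Hw |].
    apply C_derivable_mult; [apply C_derivable_const |].
    assert (Hwz : forall k, C_derivable (fun w => (w * z) ^ k) w).
    { intros k. apply C_derivable_pow.
      apply C_derivable_mult; [apply C_derivable_id | apply C_derivable_const]. }
    apply C_derivable_mult; [| apply Hwz].
    apply (C_derivable_comp Cexp); [apply C_derivable_Cexp | apply Hwz].
  - intros m [[n [Hn En]] [Himu [Hm Em]]].
    assert (Ea : RtoC rho * (1 - mu) = - RtoC (INR m)).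
    { apply injective_projections; simpl; unfold Re, Im in *; rewrite ?Em, ?Himu; field; lra. }
    set (f := fun w => RtoC rho / (RtoC 2 * RtoC PI * Ci)
      * (Cexp ((w * z) ^ n) * / (w * z) ^ m) / (w - 1)).
    destruct (descends_at_0 F f) as [H1 H2].
    { intros r phi Hr. unfold F, Phi, f. rewrite Ea, En.
      rewrite polar_pow_INR, polar_pow_opp_INR, !Hz by now apply Rmult_lt_0_compat.
      reflexivity. }
    split; [exact H1 |]. exists f. split; [| exact H2].
    (* In f = h / w^m the factor z^m of (w z)^m goes into h. *)
    set (h := fun w => RtoC rho / (RtoC 2 * RtoC PI * Ci)
      * (Cexp ((w * z) ^ n) * / z ^ m) / (w - 1)).
    assert (Hzm : z ^ m <> 0) by now apply Cpow_nz.
    assert (Hfh : forall w : C, w <> 1 -> w <> 0 -> f w = h w / (w - 0) ^ m).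
    { intros w Hw1 Hw0.
      assert (Hwm : w ^ m <> 0) by now apply Cpow_nz.
      unfold f, h. replace (w - 0) with w by ring. rewrite (Cpow_mult_l w z m).
      set (c := RtoC rho / _). field.
      repeat split; auto. intros E; apply Hw1.
      transitivity (w - 1 + 1); [ring | rewrite E; ring]. }
    split; [exact Hm |]. exists h. split; [| split].
    + revert Hnear0; unfold holomorphic_at; apply filter_imp; intros w Hw.
      apply C_derivable_div_sub_1; [exact Hw |].
      apply C_derivable_mult; [apply C_derivable_const |].
      apply C_derivable_mult; [| apply C_derivable_const].
      apply (C_derivable_comp Cexp); [apply C_derivable_Cexp | apply C_derivable_pow].
      apply C_derivable_mult; [apply C_derivable_id | apply C_derivable_const].
    + unfold h.
      assert (Hm1 : 0 - 1 <> 0) by (intros E; injection E; lra).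
      apply Cmult_neq_0; [| now apply Cinv_neq_0].
      apply Cmult_neq_0; [now apply prefactor_neq_0 |].
      apply Cmult_neq_0; [apply Cexp_neq_0 | now apply Cinv_neq_0].
    + unfold locally', within. revert Hnear0. apply filter_imp. auto.
  - intros Hreg Hpole. apply Classical_Prop.NNPP. intros Hbr.
    destruct (exponents_integer rho mu (Cmod z) psi Hrho Ht Hbr) as [[k Hk] [l Hl]].
    assert (Hint : exists n : nat, (1 <= n)%nat /\ rho = INR n).
    { exists (Z.to_nat k).
      assert (0 < k)%Z by (apply lt_IZR; lra).
      split; [lia |]. rewrite INR_IZR_INZ, Z2Nat.id by lia. exact Hk. }
    destruct mu as [mr mi]. injection Hl; simpl; intros Hi Hr.
    assert (Hmi : mi = 0%R).
    { apply (Rmult_eq_reg_l rho); [lra | exact Hrho]. }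
    assert (Hmr : mr = (1 - IZR l / rho)%R) by (rewrite <- Hr, Hmi; field; exact Hrho).
    destruct (Z_le_gt_dec 0 l) as [Hl0 | Hl0].
    + apply Hreg. split; [exact Hint |]. split; [exact Hmi |].
      exists (Z.to_nat l). rewrite INR_IZR_INZ, Z2Nat.id by lia. exact Hmr.
    + apply (Hpole (Z.to_nat (- l))). split; [exact Hint |]. split; [exact Hmi |].
      split; [lia |]. rewrite INR_IZR_INZ, Z2Nat.id, opp_IZR by lia.
      simpl. rewrite Hmr. field. exact Hrho.
Qed.
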